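(* Let $(G,\cdot)$ and $(H,\ast)$ be S-groupoids. If $(G,\cdot)$ and $(H,\ast)$ are S-isotopic, then $(H,\ast)$ is S-isomorphic to some Smarandache principal isotope $(G,\circ)$ of $(G,\cdot)$.
   Context: A groupoid $(L,\cdot)$ is a non-empty set with a binary operation. An S-groupoid (Smarandache groupoid) is a groupoid $(L,\cdot)$ having at least one non-trivial subset $M\subset L$ (a proper subset with more than one element) such that $(M,\cdot)$ is a subsemigroup, i.e. closed and associative; such an $M$ is called an S-subsemigroup. Maps are written on the right. An isotopism $(U,V,W):(L,\cdot)\to(K,\circ)$ is a triple of bijections $L\to K$ with $xU\circ yV=(x\cdot y)W$ for all $x,y\in L$. If $(L,\cdot)$ and $(K,\circ)$ are S-groupoids with S-subsemigroups $L'$ and $K'$ respectively, the isotopism is an S-isotopism if $(L')A=K'$ for every $A\in\{U,V,W\}$. S-groupoids are S-isotopic if there is an S-isotopism between them (for some S-subsemigroups $L',K'$). An S-isotopism with $U=V=W$ is an S-isomorphism, and then the S-groupoids are called S-isomorphic. If $K=L$ as sets and $W=I$ is the identity map, an S-isotopism $(U,V,I):(L,\cdot)\to(L,\circ)$ is called a Smarandache principal isotopism and $(L,\circ)$ is called a Smarandache principal isotope of $(L,\cdot)$. *)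

(* Defs.v *)
From mathcomp Require Import all_boot.
From mathcomp Require Import boolp classical_sets.
Set Implicit Arguments.
Unset Strict Implicit.
Unset Printing Implicit Defensive.
Local Open Scope classical_set_scope.

(* A groupoid is a carrier type with a binary operation on it. The operation is
   unbundled because a principal isotope is a second operation on the same
   carrier. Nonemptiness of the carrier is not required separately: an
   S-subsemigroup has two distinct elements. *)

Definition nontrivial_subset (L : Type) (M : set L) : Prop :=
  M `<` [set: L] /\ exists x y, [/\ M x, M y & x <> y].

Definition subsemigroup (L : Type) (op : L -> L -> L) (M : set L) : Prop :=
  (forall x y, M x -> M y -> M (op x y)) /\
  (forall x y z, M x -> M y -> M z -> op (op x y) z = op x (op y z)).

Definition S_subsemigroup (L : Type) (op : L -> L -> L) (M : set L) : Prop :=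
  nontrivial_subset M /\ subsemigroup op M.

Definition S_groupoid (L : Type) (op : L -> L -> L) : Prop :=
  exists M : set L, S_subsemigroup op M.

(* Maps written on the right in the source, xU, are applied as U x here. *)
Definition isotopism (L K : Type) (opL : L -> L -> L) (opK : K -> K -> K)
    (U V W : L -> K) : Prop :=
  [/\ bijective U, bijective V, bijective W
    & forall x y, opK (U x) (V y) = W (opL x y)].

Definition S_isotopism (L K : Type) (opL : L -> L -> L) (opK : K -> K -> K)
    (L' : set L) (K' : set K) (U V W : L -> K) : Prop :=
  [/\ S_subsemigroup opL L', S_subsemigroup opK K', isotopism opL opK U V W
    & [/\ U @` L' = K', V @` L' = K' & W @` L' = K']].

Definition S_isotopic (L K : Type) (opL : L -> L -> L) (opK : K -> K -> K)
    : Prop :=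
  exists (L' : set L) (K' : set K) (U V W : L -> K),
    S_isotopism opL opK L' K' U V W.

Definition S_isomorphism (L K : Type) (opL : L -> L -> L) (opK : K -> K -> K)
    (L' : set L) (K' : set K) (U : L -> K) : Prop :=
  S_isotopism opL opK L' K' U U U.

Definition S_isomorphic (L K : Type) (opL : L -> L -> L) (opK : K -> K -> K)
    : Prop :=
  exists (L' : set L) (K' : set K) (U : L -> K),
    S_isomorphism opL opK L' K' U.

Definition S_principal_isotopism (L : Type) (op op' : L -> L -> L)
    (L' K' : set L) (U V : L -> L) : Prop :=
  S_isotopism op op' L' K' U V idfun.

(* op' is a Smarandache principal isotope of op. *)
Definition S_principal_isotope (L : Type) (op op' : L -> L -> L) : Prop :=
  exists (L' K' : set L) (U V : L -> L),
    S_principal_isotopism op op' L' K' U V.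

(* Main.v *)
From mathcomp Require Import all_boot.
From mathcomp Require Import classical_sets.
Require Import Defs.

(** Let (U, V, W) be an S-isotopism from dot to star carrying L' to K'. Pull star
    back along W: circ x y = W^-1 (star (W x) (W y)). By construction W^-1 is an
    isomorphism from star to circ ([S_isomorphism_transport]), and following the
    isotopism (U, V, W) by the isomorphism W^-1 gives an isotopism
    (W^-1 \o U, W^-1 \o V, W^-1 \o W) from dot to circ whose third component is
    the identity. Since U, V and W all carry L' to K', and hence W^-1 carries K'
    to L', the three composites carry L' to itself, which is therefore the
    S-subsemigroup used on both sides. *)

Lemma nontrivial_subset_image {K L : Type} {f : K -> L} {M : set K} :
  bijective f -> nontrivial_subset M -> nontrivial_subset (f @` M)%classic.
Proof.
move=> bij_f [[_ properM] [x [y [Mx My neq_xy]]]].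
have inj_f := bij_inj bij_f.
split.
  split=> // full; apply: properM => z _.
  by have [w Mw /inj_f <-] := full (f z) I.
by exists (f x), (f y); split; [exists x | exists y | move/inj_f].
Qed.

(** Inside a product of transported elements every g meets an f and cancels, so
    closure and associativity on the image of M are those on M itself. *)
Lemma S_isomorphism_transport {K L : Type} {op : K -> K -> K} {M : set K}
    {f : K -> L} {g : L -> K} :
  cancel f g -> cancel g f -> S_subsemigroup op M ->
  S_isomorphism op (fun x y => f (op (g x) (g y))) M (f @` M)%classic f.
Proof.
move=> fK gK subM.
have bij_f : bijective f by exists g.
split=> //; last by split=> // x y; rewrite !fK.
have [ntM [closedM assocM]] := subM.
split; first exact: nontrivial_subset_image.
split=> [_ _ [x Mx <-] [y My <-] | _ _ _ [x Mx <-] [y My <-] [z Mz <-]].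
  by rewrite !fK; exists (op x y) => //; apply: closedM.
by rewrite !fK assocM.
Qed.

Theorem theorem4p1 (G H : Type) (dot : G -> G -> G) (star : H -> H -> H)
    (hG : S_groupoid dot) (hH : S_groupoid star)
    (hGH : S_isotopic dot star) :
  exists circ : G -> G -> G,
    S_principal_isotope dot circ /\ S_isomorphic star circ.
Proof.
case: hGH => L' [K' [U [V [W [subL subK isoUVW [imU imV imW]]]]]].
case: isoUVW => bijU bijV [W' WK W'K] morphUVW.
have bijW' : bijective W' by exists W.
have imW' : (W' @` K' = L')%classic.
  by rewrite -imW image_comp; apply: eq_image_id => x _; apply: WK.
have isoW' := S_isomorphism_transport W'K WK subK.
exists (fun x y => W' (star (W x) (W y))); split; last first.
  by exists K', (W' @` K')%classic, W'.
rewrite imW' in isoW'; case: isoW' => _ subL_circ _ _.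
exists L', L', (W' \o U), (W' \o V); split=> //.
  split; [exact: bij_comp | exact: bij_comp | by exists idfun |].
  by move=> x y /=; rewrite !W'K morphUVW WK.
by rewrite image_id -(image_comp U) -(image_comp V) imU imV.
Qed.
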